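(* Let $F$ be a non-constant locally uniformly recurrent meromorphic function on $\mathbb C$. Then \[ \liminf_{R\to\infty}\frac{T_F(R)}{R^2}>0 . \]
   Context: Meromorphic functions are treated as (holomorphic) maps of $\mathbb C$ into the Riemann sphere endowed with the spherical metric $\rho$, and $(\tau_wF)(z)=F(z+w)$. A set $W\subset\mathbb C$ is relatively dense if every disk of sufficiently large radius contains at least one point of $W$. A meromorphic function $F$ is locally uniformly recurrent if for every $\varepsilon>0$ and every compact set $K\subset\mathbb C$ the set $\{w\in\mathbb C\colon\max_K\rho(\tau_wF,F)<\varepsilon\}$ is relatively dense in $\mathbb C$. The Nevanlinna characteristic in Ahlfors–Shimizu form is \[ T_F(R)=\int_0^R\Bigl(\frac1\pi\int_{|z|<r}F^{\#}(z)^2\,dA(z)\Bigr)\frac{dr}{r},\qquad F^{\#}(z)=\frac{|F'(z)|}{1+|F(z)|^2}, \] where $A$ is area (Lebesgue) measure and the spherical derivative $F^{\#}$ is extended to poles by continuity. *)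

(* Defs.v *)
From HB Require Import structures.
From mathcomp Require Import all_boot all_order all_algebra.
From mathcomp Require Import all_classical all_reals all_analysis.
From mathcomp.real_closed Require Export complex.

Set Implicit Arguments.
Unset Strict Implicit.
Unset Printing Implicit Defensive.

Import Order.TTheory GRing.Theory Num.Theory.
Import numFieldNormedType.Exports.

Local Open Scope classical_set_scope.
Local Open Scope ring_scope.
Local Open Scope complex_scope.

(* R[i] seen as a numFieldType: this is the form for which MathComp-Analysis
   infers the topology and the structure of normed space over itself, so that
   [derivable f z 1] is complex differentiability. *)
Definition Cplx (R : realType) : numFieldType := R[i].

(* The modulus as an element of R, whereas `|z| has type R[i]. *)
Definition modC (R : realType) (z : Cplx R) : R := complex.Re (`|z| : R[i]).

Definition sphere (R : realType) : Type := one_point_compactification (Cplx R).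

(* The affine coordinate; the value at infinity is a dummy. *)
Definition affine (R : realType) (p : sphere R) : Cplx R :=
  if p is Some w then w else 0.

(* The inversion w |-> 1/w of the sphere, exchanging 0 and infinity. *)
Definition sinv (R : realType) (p : sphere R) : sphere R :=
  if p is Some w then (if w == 0 then None else Some w^-1) else Some 0.

Definition holomorphic_chart (R : realType) (F : Cplx R -> sphere R)
    (z : Cplx R) : Prop :=
  \forall w \near z, F w <> None /\ derivable (@affine R \o F) w 1.

(* Holomorphic maps from C to the sphere: near every point, F or 1/F is a finite
   holomorphic function. The constant map infinity, which is the only such map
   that is not usually called meromorphic, is allowed. *)
Definition meromorphic (R : realType) (F : Cplx R -> sphere R) : Prop :=
  forall z, holomorphic_chart F z \/ holomorphic_chart (@sinv R \o F) z.

(* Inverse stereographic projection onto the unit sphere of R^3. *)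
Definition stereo (R : realType) (p : sphere R) : R * R * R :=
  if p is Some w then
    let d := 1 + modC w ^+ 2 in
    (2 * complex.Re (w : R[i]) / d, 2 * complex.Im (w : R[i]) / d,
     (modC w ^+ 2 - 1) / d)
  else (0, 0, 1).

(* Great-circle distance. The factor 1/2 normalizes it to be the geodesic
   distance of the length element |dw| / (1 + |w|^2), which is the one
   underlying the spherical derivative below. *)
Definition rho (R : realType) (p q : sphere R) : R :=
  let: (x, y, t) := stereo p in
  let: (x', y', t') := stereo q in
  acos (x * x' + y * y' + t * t') / 2.

Definition translate (R : realType) (w : Cplx R) (F : Cplx R -> sphere R) :
    Cplx R -> sphere R :=
  fun z => F (z + w).

Definition relatively_dense (R : realType) (W : set (Cplx R)) : Prop :=
  \forall r \near +oo%R, forall a : Cplx R, exists2 w, W w & modC (w - a) < r.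

(* The supremum is a maximum: rho is bounded, F is continuous and K is compact
   (and for K empty it is 0). *)
Definition locally_uniformly_recurrent (R : realType)
    (F : Cplx R -> sphere R) : Prop :=
  forall (eps : R) (K : set (Cplx R)), 0 < eps -> compact K ->
    relatively_dense
      [set w | sup [set rho (translate w F z) (F z) | z in K] < eps].

Definition spherical_derivative_finite (R : realType)
    (F : Cplx R -> sphere R) (z : Cplx R) : R :=
  modC ('D_1 (@affine R \o F) z) / (1 + modC (affine (F z)) ^+ 2).

(* At a pole the value is the limit along the punctured neighborhoods. *)
Definition spherical_derivative (R : realType)
    (F : Cplx R -> sphere R) (z : Cplx R) : R :=
  if F z is Some _ then spherical_derivative_finite F z
  else lim (spherical_derivative_finite F @ z^').

(* C is identified with R * R to integrate with respect to area. *)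
Definition spherical_area (R : realType) (F : Cplx R -> sphere R) (r : R) :
    \bar R :=
  (\int[lebesgue_measure \x lebesgue_measure]_(p in
      [set p : R * R | (modC (p.1 +i* p.2) < r)%R])
    (spherical_derivative F (p.1 +i* p.2) ^+ 2)%:E)%E.

Definition characteristic (R : realType) (F : Cplx R -> sphere R) (rad : R) :
    \bar R :=
  (\int[lebesgue_measure]_(r in `]0%R, rad[)
    ((pi^-1)%:E * spherical_area F r * (r^-1)%:E))%E.

(* Main.v *)
Require Import Defs.
From mathcomp Require Import all_boot all_order all_algebra.
From mathcomp Require Import all_classical all_reals all_analysis.
From mathcomp Require Import measurable_realfun.
From mathcomp Require Import ring lra.

Import Order.TTheory GRing.Theory Num.Theory.
Import numFieldNormedType.Exports.

Local Open Scope classical_set_scope.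
Local Open Scope ring_scope.

(** Let f be the affine coordinate of F.

    Since F is not constant, f has a nonzero derivative at some point, hence
    there is a small square K, free of poles, on which f is bounded and such
    that the values of f at the two ends of every horizontal side-to-side
    segment of K are at distance at least 3e ([oscillating_square]).  If the
    translate of F by w is close enough to F on K in the spherical metric, then
    it is finite and within e of f on K ([rho_lt_affine]).  So f is bounded on
    the square w + K, and its values at the ends of the horizontal segments of
    w + K still differ by e at least.  By recurrence every large enough disk
    contains such a square ([recurrent_energy]).

    A function of one variable that moves by e over a length h has Dirichlet
    energy at least e^2 / h, by Cauchy-Schwarz.  Integrating over the horizontal
    segments of w + K gives a lower bound for the integral of |f'|^2 over w + K
    that does not depend on w ([square_energy]), and as f is bounded there this
    bounds the spherical area from below.  A disk of radius r contains of the
    order of r^2 disjoint cells, each containing one of these squares, so its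
    spherical area is at least c r^2 ([quadratic_area_growth]); integrating in r
    gives the growth of the characteristic.

    The argument uses no integral formula.  Complex derivatives are merely known
    to exist at each point, so the bound of the increment of f over a segment by
    the integral of |f'| is proved for everywhere differentiable functions
    ([variation_le_integral]).  The measurability of |f'| holds because f' is a
    pointwise limit of difference quotients. *)

(** * Lower bounds for integrals *)

(** The integral of a nonnegative function is a supremum over the simple
    functions below it, hence it is monotone even on functions that are not
    known to be measurable.  The spherical derivative is such a function, since
    its values at the poles are limits. *)
Lemma ge0_le_integral_lower {d} {T : measurableType d} {R : realType}
    (mu : {measure set T -> \bar R}) (A D : set T) (f g : T -> \bar R) :
  A `<=` D -> (forall x, D x -> (0 <= g x)%E) ->
  (forall x, A x -> (0 <= f x <= g x)%E) ->
  (\int[mu]_(x in A) f x <= \int[mu]_(x in D) g x)%E.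
Proof.
move=> AD g0 fg.
rewrite !ge0_integralE//; last by move=> x /fg /andP[].
apply: le_ereal_sup => _ [h /= hf <-]; exists h => //= x.
apply: le_trans (hf x) _; rewrite !patchE.
case: ifPn => [|_].
  by rewrite inE => Ax; rewrite mem_set; [case/andP: (fg x Ax)|exact: AD].
by case: ifPn => //; rewrite inE => /g0.
Qed.

Lemma cst_le_integral {d} {T : measurableType d} {R : realType}
    (mu : {measure set T -> \bar R}) (A D : set T) (c : R) (f : T -> \bar R) :
  measurable A -> A `<=` D -> 0 <= c -> (forall x, D x -> (0 <= f x)%E) ->
  (forall x, A x -> (c%:E <= f x)%E) ->
  (c%:E * mu A <= \int[mu]_(x in D) f x)%E.
Proof.
move=> mA AD c0 f0 cf; rewrite -integral_cst//.
by apply: ge0_le_integral_lower => // x Ax; rewrite lee_fin c0 cf.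
Qed.

Lemma measure_setDUK {d} {T : measurableType d} {R : realType}
    (mu : {measure set T -> \bar R}) (A B : set T) :
  measurable A -> measurable B -> A `<=` B ->
  (mu A + mu (B `\` A))%E = mu B.
Proof.
move=> mA mB AB; rewrite -measureU//; first by rewrite setDUK.
  exact: measurableD.
by rewrite setDIK.
Qed.

Lemma ge0_integral_affine {d} {T : measurableType d} {R : realType}
    (mu : {measure set T -> \bar R}) (D : set T) (g : T -> R) (k c : R) :
  measurable D -> measurable_fun D g -> (forall x, D x -> 0 <= g x) ->
  0 <= k -> 0 <= c ->
  (\int[mu]_(x in D) (k * g x + c)%:E =
   k%:E * \int[mu]_(x in D) (g x)%:E + c%:E * mu D)%E.
Proof.
move=> mD mg g0 k0 c0; under eq_integral do rewrite EFinD EFinM.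
have mgE : measurable_fun D (fun x => (g x)%:E) by exact/measurable_EFinP.
rewrite ge0_integralD//.
- by rewrite ge0_integralZl_EFin// integral_cst.
- by move=> x Dx; rewrite mule_ge0// lee_fin ?g0.
- exact: measurable_funeM.
Qed.

(** Superadditivity over disjoint sets, for an integrand g that need not be
    measurable: it passes through the measurable minorant k * f. *)
Lemma ge0_integral_disjoint_lower {d} {T : measurableType d} {R : realType}
    (mu : {measure set T -> \bar R}) (I : choiceType) (s : seq I)
    (Q : I -> set T) (D U : set T) (f : T -> R) (g : T -> \bar R) (k c : R) :
  uniq s -> (forall i, measurable (Q i)) -> trivIset [set` s] Q ->
  (forall i, i \in s -> Q i `<=` D) -> measurable U ->
  (forall i, Q i `<=` U) -> measurable_fun U f ->
  (forall x, 0 <= f x) -> (forall x, D x -> (0 <= g x)%E) -> 0 <= k ->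
  (forall i x, Q i x -> ((k * f x)%:E <= g x)%E) ->
  (forall i, (c%:E <= \int[mu]_(x in Q i) (f x)%:E)%E) ->
  ((k * c * (size s)%:R)%:E <= \int[mu]_(x in D) g x)%E.
Proof.
move=> us mQ tQ QD mU QU mf f0 g0 k0 fg cf.
pose V := \big[setU/set0]_(i <- s) Q i.
have VE x : V x -> exists2 i, i \in s & Q i x.
  by rewrite /V -bigcup_seq => -[i /= si Qi]; exists i.
apply: (@le_trans _ _ (\int[mu]_(x in V) (k * f x)%:E)%E); last first.
  apply: ge0_le_integral_lower => //.
    by move=> x /VE[i si]; exact: QD.
  by move=> x /VE[i si Qi]; rewrite lee_fin mulr_ge0//= (fg i).
rewrite ge0_integral_bigsetU//; last 2 first.
- apply/measurable_EFinP; apply: measurable_funM => //.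
  by apply: measurable_funS mf => // x /VE[i _]; exact: QU.
- by move=> x _; rewrite lee_fin mulr_ge0.
have -> : (k * c * (size s)%:R)%:E = (\sum_(i <- s) (k * c)%:E)%E.
  by rewrite sumEFin big_const_seq count_predT iter_addr_0 mulr_natr.
apply: lee_sum => i _.
have mfi : measurable_fun (Q i) f by exact: measurable_funS mf.
have := @ge0_integral_affine _ _ _ mu (Q i) f k 0 (mQ i) mfi
  (fun x _ => f0 x) k0 (lexx _).
rewrite mul0e adde0; under eq_integral do rewrite addr0.
by move=> ->; rewrite EFinM lee_wpmul2l// lee_fin.
Qed.

(** * Increments over a segment *)

(** The compactness of [a, b], in the form of an induction principle: a relation
    between the endpoints of an interval that is transitive and holds on all
    small intervals around each point holds on [a, b].  The supremum of the
    points that [a] reaches is reached, and cannot be less than [b]. *)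
Lemma cousin {R : realType} (P : R -> R -> Prop) (a b : R) : a <= b ->
  (forall x, a <= x <= b -> exists2 d, 0 < d & forall u v,
     a <= u -> u <= x -> x <= v -> v <= b -> x - d < u -> v < x + d -> P u v) ->
  (forall u v w, u <= v -> v <= w -> P u v -> P v w -> P u w) ->
  P a b.
Proof.
move=> ab loc tr.
pose S := [set t | a <= t <= b /\ P a t].
have Sa : S a.
  split; first by rewrite lexx.
  have [|d d0] := loc a; first by rewrite lexx.
  by apply=> //; rewrite ?ltrDl// ltrBlDr ltrDl.
have supS : has_sup S.
  by split; [exists a|exists b => t [/andP[]]].
set c := sup S.
have ac : a <= c by apply: ub_le_sup => //; case: supS.
have cb : c <= b by apply: ge_sup; [exists a|move=> t [/andP[]]].
have [|d d0 locc] := loc c; first by rewrite ac.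
have [t [/andP[at_ tb] Pat] ct] := sup_adherent d0 supS.
have tc : t <= c by apply: ub_le_sup; [case: supS|split=> //; rewrite at_].
pose v := Num.min b (c + d / 2).
have cv : c <= v by rewrite le_min cb/= lerDl divr_ge0// ltW.
have vb : v <= b by rewrite ge_min lexx.
have vc : v < c + d.
  rewrite gt_min; apply/orP; right.
  by rewrite ltrD2l ltr_pdivrMr// ltr_pMr// ltr1n.
have Pav : P a v by apply: (tr a t v) => //; [exact: le_trans cv|exact: locc].
have : v <= c.
  by apply: ub_le_sup; [case: supS|split=> //; rewrite (le_trans ac)].
rewrite ge_min -[X in _ || X]negbK -ltNge ltrDl divr_gt0//= orbF => bc.
by have -> : b = v by apply/eqP; rewrite eq_le vb (le_trans bc).
Qed.

(** A fundamental theorem of calculus for functions that are differentiable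
    everywhere, without continuity of the derivative: G stands for the norm of
    the derivative and dst for the distance between the values at two points.

    Cut [a, b] into the level sets E k on which G is nearly k * eta, enclose
    each of them in an open set V k of nearly the same measure, and let h be
    the sum over k of (k + 2) * eta times the indicator of V k.  The integral
    of h is nearly that of G.  As each V k is open, h is at least
    G x + eta on a whole neighborhood of each point x of E k, so that the
    increments of dst around x are at most the integral of h; conclude by
    [cousin]. *)
Lemma variation_le_integral {R : realType} (dst : R -> R -> R) (G : R -> R)
    (a b : R) : a <= b ->
  (forall u v w, u <= v -> v <= w -> dst u w <= dst u v + dst v w) ->
  measurable_fun `[a, b] G -> (forall x, a <= x <= b -> 0 <= G x) ->
  (forall x e, a <= x <= b -> 0 < e -> exists2 d, 0 < d & forall u v,
     a <= u -> u <= x -> x <= v -> v <= b -> x - d < u -> v < x + d ->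
     dst u v <= (G x + e) * (v - u)) ->
  ((dst a b)%:E <= \int[lebesgue_measure]_(x in `[a, b]) (G x)%:E)%E.
Proof.
move=> ab tri mG G0 loc.
set mu := lebesgue_measure.
pose I := `[a, b]%classic : set R.
have mI : measurable I by exact: measurable_itv.
apply/lee_addgt0Pr => e e0.
(* eta is chosen so that 2 * eta * (b - a) <= e / 2; the other half of e is
   spent on the sets V k minus E k. *)
pose eta : R := e / (2 * (2 * (b - a) + 1)).
have ba0 : 0 <= b - a by rewrite subr_ge0.
have eta0 : 0 < eta by rewrite divr_gt0// mulr_gt0// ltr_wpDl// mulr_ge0.
have e20 : 0 <= 2 * eta by apply: mulr_ge0 => //; exact: ltW.
pose c (k : nat) : R := (k%:R + 2) * eta.
have c0 k : 0 < c k by rewrite mulr_gt0// ltr_wpDl.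
pose E (k : nat) := I `&` G @^-1` `[k%:R * eta, (k%:R + 1) * eta[%classic.
have mE k : measurable (E k) by apply: mG => //; exact: measurable_itv.
have muI : mu I = (b - a)%:E.
  rewrite /mu lebesgue_measure_itv/= lte_fin; case: ltrP => // h.
  by congr EFin; apply/esym/eqP; rewrite subr_eq0 eq_le ab h.
have muE k : (mu (E k) < +oo)%E.
  apply: (@le_lt_trans _ _ (mu I)).
    apply: le_measure; [rewrite inE; exact: mE|rewrite inE; exact: mI|].
    by move=> ? [].
  by rewrite muI ltry.
have [V VP] : {V : nat -> set R & forall k, [/\ open (V k), E k `<=` V k &
    (mu (V k `\` E k) < (e / 2 / (2 ^ k.+1)%:R / c k)%:E)%E]}.
  apply: (@choice nat (set R) (fun k V => [/\ open V, E k `<=` V &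
    (mu (V `\` E k) < (e / 2 / (2 ^ k.+1)%:R / c k)%:E)%E])) => k.
  by apply: lebesgue_regularity_outer => //; do 3 (apply: divr_gt0 => //).

pose h (t : R) : \bar R := (\sum_(k <oo) (c k * \1_(V k) t)%:E)%E.
have mV k : measurable (V k) by apply: open_measurable; case: (VP k).
have cV0 k t : (0 <= (c k * \1_(V k) t)%:E)%E.
  by rewrite lee_fin mulr_ge0// ltW.
have mcV k (D : set R) : measurable_fun D (fun t => (c k * \1_(V k) t)%:E).
  apply/measurable_EFinP; apply: measurable_funM => //.
have h0 t : (0 <= h t)%E by apply: nneseries_ge0.
have mh (D : set R) : measurable_fun D h.
  by apply: measurable_funTS; apply: ge0_emeasurable_sum => // k _; exact: mcV.
have step1 : ((dst a b)%:E <= \int[mu]_(t in `]a, b]) h t)%E.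
  pose P u v := ((dst u v)%:E <= \int[mu]_(t in `]u, v]) h t)%E.
  apply: (@cousin R P) => //; last first.
    move=> u v w uv vw Puv Pvw; rewrite /P.
    rewrite (@itv_bndbnd_setU _ _ _ (BRight v)); [|by rewrite bnd_simp..].
    rewrite ge0_integral_setU//=.
    - apply: le_trans (leeD Puv Pvw).
      by rewrite -EFinD lee_fin tri.
    - exact: mh.
    - rewrite disj_set2E; apply/eqP/seteqP; split => x //=.
      by rewrite !in_itv/= => -[/andP[_ xv] /andP[]]; rewrite ltNge xv.
  move=> x abx.
  pose k := Num.truncn (G x / eta).
  have Gx0 : 0 <= G x / eta by rewrite divr_ge0// ?G0// ltW.
  have Ekx : E k x.
    split => /=; first by rewrite ?in_itv.
    have /andP[h1 h2] := truncn_itv Gx0.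
    by rewrite in_itv/= -ler_pdivlMr// -ltr_pdivrMr// h1/= -natr1 in h2 *.
  have [oV EV _] := VP k.
  have [d1 d10 dV] : exists2 d1, 0 < d1 & forall y, `|x - y| < d1 -> V k y.
    have /nbhs_ballP[d1 /= d10 dV] : nbhs x (V k).
      by apply: open_nbhs_nbhs; split=> //; exact: EV.
    by exists d1 => // y xy; exact: dV.
  have [d2 d20 dd] := loc x eta abx eta0.
  exists (Num.min d1 d2); first by rewrite lt_min d10.
  move=> u v au ux xv vb ud vd; rewrite /P.
  have uv : u <= v by exact: le_trans xv.
  have Gc : G x + eta <= c k.
    by case: Ekx => _ /=; rewrite in_itv/= => /andP[_ /ltW]; rewrite /c; lra.
  apply: (@le_trans _ _ (c k * (v - u))%:E).
    rewrite lee_fin; apply: le_trans (dd u v _ _ _ _ _ _) _ => //.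
    - by apply: le_lt_trans ud; rewrite lerD2l lerN2 ge_min lexx orbT.
    - by apply: lt_le_trans vd _; rewrite lerD2l ge_min lexx orbT.
    - by rewrite ler_wpM2r// subr_ge0.
  have <- : (\int[mu]_(t in `]u, v]) (cst (c k)%:E) t)%E = (c k * (v - u))%:E.
    rewrite integral_cst//= /mu lebesgue_measure_itv/= lte_fin.
    case: ltrP => [_|vu]; first by rewrite -EFinD -!EFinM.
    have -> : u = v by apply/eqP; rewrite eq_le uv.
    by rewrite subrr mulr0 mule0.
  apply: ge0_le_integral_lower => // t; rewrite /= in_itv/= => /andP[ut tv].
  rewrite lee_fin ltW//=.
  have Vt : V k t.
    apply: dV; rewrite ltr_norml.
    have ud1 : x - d1 < u.
      by apply: le_lt_trans ud; rewrite lerD2l lerN2 ge_min lexx.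
    have vd1 : v < x + d1.
      by apply: lt_le_trans vd _; rewrite lerD2l ge_min lexx.
    by apply/andP; split; lra.
  rewrite /h (@nneseries_split _ _ 0 k.+1)//.
  rewrite big_mkord big_ord_recr/= indicE mem_set// mulr1.
  apply: (@le_trans _ _ (\sum_(i < k) (c i * \1_(V i) t)%:E + (c k)%:E)%E).
    by rewrite leeDr// sume_ge0.
  by rewrite leeDl// nneseries_ge0.
apply: le_trans step1 _.
have muIi : (\int[mu]_(t in `]a, b]) h t <= \int[mu]_(t in I) h t)%E.
  apply: ge0_le_integral_lower => //; last by move=> x _; rewrite h0 lexx.
  exact: subset_itv_oc_cc.
apply: le_trans muIi _.
have IE : I = \bigcup_k E k.
  apply/seteqP; split => [x /= Ix|x [k _ []//]].
  have Gx0 : 0 <= G x / eta by rewrite divr_ge0// ?G0// ltW.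
  exists (Num.truncn (G x / eta)) => //; split => //=.
  have /andP[h1 h2] := truncn_itv Gx0.
  by rewrite in_itv/= -ler_pdivlMr// -ltr_pdivrMr// h1/= -natr1 in h2 *.
have tE : trivIset setT E.
  apply/trivIsetP => i j _ _ ij; apply/seteqP; split => x //=.
  rewrite /E /= !in_itv/= => -[[_ /andP[ix xi]] [_ /andP[jx xj]]].
  move: ij; rewrite neq_ltn => /orP[] ij; exfalso.
    have : (i%:R + 1) * eta <= j%:R * eta :> R.
      by rewrite ler_pM2r// natr1 ler_nat.
    by move=> H; move: (lt_le_trans xi H); rewrite ltNge jx.
  have : (j%:R + 1) * eta <= i%:R * eta :> R.
    by rewrite ler_pM2r// natr1 ler_nat.
  by move=> H; move: (lt_le_trans xj H); rewrite ltNge ix.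
have GE : measurable_fun I (fun x => (G x + 2 * eta)%:E).
  by apply/measurable_EFinP; apply: measurable_funD.
rewrite integral_nneseries//; last by move=> n; exact: mcV.
have bnd k : (\int[mu]_(t in I) (c k * \1_(V k) t)%:E <=
    \int[mu]_(x in E k) (G x + 2 * eta)%:E + (e / 2 / (2 ^ k.+1)%:R)%:E)%E.
  have [oV EV muVE] := VP k.
  have mi : measurable_fun I (fun x : R => (\1_(V k) x : R)%:E).
    by apply/measurable_EFinP; exact: measurable_indic.
  under eq_integral do rewrite EFinM.
  rewrite ge0_integralZl_EFin//; last exact: ltW.
  rewrite integral_indic; [|exact: mI|exact: mV].
  have mVI : measurable (V k `&` I) by exact: measurableI.
  have mVE : measurable (V k `\` E k) by exact: measurableD.
  apply: (@le_trans _ _ ((c k)%:E * (mu (E k) + mu (V k `\` E k)))%E).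
    apply: lee_wpmul2l; first by rewrite lee_fin ltW.
    apply: (@le_trans _ _ (mu (V k))).
      by apply: le_measure;
        [rewrite inE; exact: mVI|rewrite inE; exact: mV|exact: subIsetl].
    have := @measure_setDUK _ _ _ (@lebesgue_measure R) (E k) (V k).
    move=> /(_ (mE k) (mV k) EV) VE.
    by have <- // : (mu (E k) + mu (V k `\` E k))%E = mu (V k) by exact: VE.
  rewrite muleDr//; last by rewrite ge0_adde_def// ?inE.
  apply: leeD.
    have := @cst_le_integral _ _ _ (@lebesgue_measure R) (E k) (E k) (c k)
      (fun x => (G x + 2 * eta)%:E) (mE k).
    apply => //; first exact: ltW.
    - move=> x [abx _]; rewrite lee_fin addr_ge0//.
      by apply: G0; move: abx; rewrite /I/= in_itv.
    - move=> x [_ /=]; rewrite in_itv/= lee_fin => /andP[h1 h2].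
      by rewrite /c mulrDl lerD2r.
  apply: (@le_trans _ _ ((c k)%:E * (e / 2 / (2 ^ k.+1)%:R / c k)%:E)%E).
    by apply: lee_wpmul2l; [rewrite lee_fin ltW|exact: ltW].
  by rewrite -EFinM lee_fin mulrC divfK// gt_eqF.
apply: le_trans (lee_nneseries _ _) _ => //.
- by move=> k _ _; apply: integral_ge0.
- by move=> k _; exact: bnd.
apply: le_trans (epsilon_trick _ _ _) _.
- move=> k; apply: integral_ge0 => x; rewrite {1}/E /= => -[Ix _].
  by rewrite lee_fin addr_ge0// G0.
- by rewrite divr_ge0// ltW.
rewrite -ge0_integral_bigcup//; last 2 first.
- by rewrite -IE.
- by rewrite -IE => x Ix; rewrite lee_fin addr_ge0// G0.
rewrite -IE.
under eq_integral do rewrite EFinD.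
have mGE : measurable_fun I (fun x => (G x)%:E) by exact/measurable_EFinP.
rewrite ge0_integralD//.
rewrite -addeA; apply: leeD => //.
have := @integral_cst _ _ _ (@lebesgue_measure R) I mI (2 * eta)%:E.
move=> ->; rewrite [X in (_ * X)%E](_ : _ = (b - a)%:E)//.
rewrite -EFinM -EFinD lee_fin /eta.
have : 2 * (e / (2 * (2 * (b - a) + 1))) * (b - a) <= e / 2.
  rewrite [leLHS](_ : _ = e / 2 * (2 * (b - a) / (2 * (b - a) + 1))).
    apply: ler_piMr; first by rewrite divr_ge0// ltW.
    by rewrite ler_pdivrMr ?mul1r ?lerDl// ltr_wpDl// mulr_ge0.
  by field; rewrite gt_eqF// ltr_wpDl// mulr_ge0.
lra.
Qed.

(** Cauchy-Schwarz, obtained from [variation_le_integral] and the inequality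
    s <= (s^2 / c + c) / 2 with c = e / (b - a), the slope of the minimizer of
    the energy. *)
Lemma energy_le_integral {R : realType} (dst : R -> R -> R) (g : R -> R)
    (a b e : R) : a < b -> 0 < e ->
  (forall u v w, u <= v -> v <= w -> dst u w <= dst u v + dst v w) ->
  measurable_fun `[a, b] g -> (forall x, a <= x <= b -> 0 <= g x) ->
  (forall x d, a <= x <= b -> 0 < d -> exists2 r : R, 0 < r & forall u v,
     a <= u -> u <= x -> x <= v -> v <= b -> x - r < u -> v < x + r ->
     dst u v <= (Num.sqrt (g x) + d) * (v - u)) ->
  e <= dst a b ->
  ((e ^+ 2 / (b - a))%:E <= \int[lebesgue_measure]_(x in `[a, b]) (g x)%:E)%E.
Proof.
move=> ab e0 tri mg g0 loc eab.
have ba0 : 0 < b - a by rewrite subr_gt0.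
pose c := e / (b - a); have c0 : 0 < c by rewrite divr_gt0.
have cE : c * (b - a) = e by rewrite divfK// gt_eqF.
pose k := (2 * c)^-1; have k0 : 0 < k by rewrite invr_gt0 mulr_gt0.
have kE : k * (2 * c) = 1 by rewrite mulVf// gt_eqF// mulr_gt0.
pose H x := k * g x + c / 2.
have sqrtH x : a <= x <= b -> Num.sqrt (g x) <= H x.
  move=> /g0 gx; rewrite /H -{2}(sqr_sqrtr gx); set s := Num.sqrt (g x).
  rewrite -subr_ge0 [leRHS](_ : _ = k * (s - c) ^+ 2).
    by rewrite mulr_ge0 ?sqr_ge0// ltW.
  have : s = k * (2 * c) * s by rewrite kE mul1r.
  have : c / 2 = k * (2 * c) * (c / 2) by rewrite kE mul1r.
  by move=> -> {2}->; field.
have mH : measurable_fun `[a, b] H.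
  by apply: measurable_funD => //; apply: measurable_funM.
have H0 x : a <= x <= b -> 0 <= H x.
  by move=> xab; apply: le_trans (sqrtH x xab); exact: sqrtr_ge0.
have locH x d : a <= x <= b -> 0 < d -> exists2 r : R, 0 < r & forall u v,
    a <= u -> u <= x -> x <= v -> v <= b -> x - r < u -> v < x + r ->
    dst u v <= (H x + d) * (v - u).
  move=> xab d0; have [r r0 rP] := loc x d xab d0.
  exists r => // u v au ux xv vb ur vr.
  apply: le_trans (rP u v au ux xv vb ur vr) _.
  by rewrite ler_wpM2r ?lerD2r ?sqrtH// subr_ge0 (le_trans ux).
have := @variation_le_integral R dst H a b (ltW ab) tri mH H0 locH.
have mI : measurable (`[a, b]%classic : set R) by exact: measurable_itv.
have g0I (x : R) : `[a, b]%classic x -> 0 <= g x.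
  by rewrite /= in_itv/=; exact: g0.
have := @ge0_integral_affine _ _ _ (@lebesgue_measure R) _ g k (c / 2) mI mg g0I
  (ltW k0) (divr_ge0 (ltW c0) (ler0n _ _)).
move=> ->.
rewrite [X in (_ + _ * X)%E](_ : _ = (b - a)%:E); last first.
  by have := @lebesgue_measure_itv R `[a, b]; rewrite /= lte_fin ab.
have J0 : (0 <= \int[lebesgue_measure]_(x in `[a, b]) (g x)%:E)%E.
  by apply: integral_ge0 => x /g0I; rewrite lee_fin.
case: (\int[lebesgue_measure]_(x in `[a, b]) (g x)%:E)%E J0 => [r||].
- move=> _ H1; rewrite lee_fin.
  have {}H1 : dst a b <= k * r + c / 2 * (b - a) by rewrite -lee_fin; exact: H1.
  have : e <= k * r + e / 2.
    by rewrite -[X in X / 2]cE mulrAC; exact: le_trans H1.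
  move=> H2; have H3 : e / 2 <= k * r by lra.
  have : 2 * c * (e / 2) <= 2 * c * (k * r).
    by rewrite ler_wpM2l// mulr_ge0// ltW.
  rewrite [2 * c * (k * r)]mulrA [2 * c * k]mulrC kE mul1r; apply: le_trans.
  rewrite le_eqVlt; apply/orP; left; apply/eqP; rewrite /c; field.
  by rewrite gt_eqF.
- by move=> _ _; rewrite leey.
- by rewrite leeNy_eq.
Qed.

(** * The modulus and complex differentiability *)

Lemma normCE {R : realType} (z : Cplx R) : `|z| = ((modC z)%:C)%C.
Proof. by rewrite /modC normc_def. Qed.

Lemma modCE {R : realType} (z : Cplx R) :
  modC z = Num.sqrt (complex.Re (z : R[i]) ^+ 2 + complex.Im (z : R[i]) ^+ 2).
Proof. by rewrite /modC normc_def. Qed.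

Lemma modC_ge0 {R : realType} (z : Cplx R) : 0 <= modC z.
Proof. by rewrite modCE sqrtr_ge0. Qed.

Lemma sqr_modC {R : realType} (z : Cplx R) :
  modC z ^+ 2 = complex.Re (z : R[i]) ^+ 2 + complex.Im (z : R[i]) ^+ 2.
Proof. by rewrite modCE sqr_sqrtr// addr_ge0// sqr_ge0. Qed.

Lemma modC_eq0 {R : realType} (z : Cplx R) : (modC z == 0) = (z == 0).
Proof.
rewrite -[RHS]normr_eq0 normCE.
by apply/eqP/eqP => [->//|[]].
Qed.

Lemma modC0 {R : realType} : modC (0 : Cplx R) = 0.
Proof. by apply/eqP; rewrite modC_eq0. Qed.

Lemma modCN {R : realType} (z : Cplx R) : modC (- z) = modC z.
Proof. by rewrite /modC normrN. Qed.

Lemma modCM {R : realType} (z w : Cplx R) : modC (z * w) = modC z * modC w.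
Proof.
by have := normrM z w; rewrite !normCE -rmorphM => -[].
Qed.

Lemma ler_modCD {R : realType} (z w : Cplx R) :
  modC (z + w) <= modC z + modC w.
Proof.
have := ler_normD z w; rewrite !normCE -rmorphD/= lecE/=.
by move=> /andP[].
Qed.

Lemma modCB {R : realType} (z w : Cplx R) : modC (z - w) = modC (w - z).
Proof. by rewrite -modCN opprB. Qed.

Lemma ler_modC_dist {R : realType} (u v w : Cplx R) :
  modC (u - w) <= modC (u - v) + modC (v - w).
Proof. by apply: le_trans (ler_modCD _ _); rewrite addrA subrK. Qed.

Lemma modC_real {R : realType} (x : R) : modC (x%:C%C : Cplx R) = `|x|.
Proof. by rewrite modCE/= expr0n addr0 sqrtr_sqr. Qed.

Lemma ler_modC_Re_Im {R : realType} (z : Cplx R) :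
  modC z <= `|complex.Re (z : R[i])| + `|complex.Im (z : R[i])|.
Proof.
rewrite -(@ler_pXn2r _ 2)// ?nnegrE ?addr_ge0// ?modC_ge0//.
rewrite sqr_modC sqrrD !real_normK ?num_real// lerD2r lerDl.
by rewrite mulrn_wge0// mulr_ge0.
Qed.

Lemma ler_Re_modC {R : realType} (z : Cplx R) :
  `|complex.Re (z : R[i])| <= modC z.
Proof.
rewrite -(@ler_pXn2r _ 2)// ?nnegrE// ?modC_ge0//.
by rewrite sqr_modC real_normK ?num_real// lerDl sqr_ge0.
Qed.

Lemma ler_Im_modC {R : realType} (z : Cplx R) :
  `|complex.Im (z : R[i])| <= modC z.
Proof.
rewrite -(@ler_pXn2r _ 2)// ?nnegrE// ?modC_ge0//.
by rewrite sqr_modC real_normK ?num_real// lerDr sqr_ge0.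
Qed.

(** Balls of the complex plane have radii in [R[i]]; this trades them for real
    radii and the real-valued modulus. *)
Lemma near_CplxP {R : realType} (z : Cplx R) (P : Cplx R -> Prop) :
  (\forall w \near z, P w) <->
  exists2 d : R, 0 < d & forall w, modC (w - z) < d -> P w.
Proof.
split.
  move=> /nbhs_ballP[e /= e0 eP].
  have eE : (complex.Re (e : R[i]))%:C%C = e.
    by move: e0; case: (e) => a b; rewrite ltcE/= => /andP[/eqP ->].
  exists (complex.Re (e : R[i])).
    by move: e0; rewrite -eE ltcE/= => /andP[].
  move=> w wz; apply: eP; rewrite /ball/= -[e]eE distrC normCE ltcE/= eqxx.
  exact: wz.
move=> [d d0 dP]; apply/nbhs_ballP; exists (d%:C%C) => /=.
  by rewrite ltcE/= eqxx.
by move=> w; rewrite /ball/= distrC normCE ltcE/= => /andP[_ ?]; exact: dP.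
Qed.

Lemma derivable_CplxP {R : realType} (f : Cplx R -> Cplx R) (z : Cplx R)
    (e : R) : derivable f z 1 -> 0 < e ->
  exists2 d : R, 0 < d & forall h, modC h < d ->
    modC (f (z + h) - f z - 'D_1 f z * h) <= e * modC h.
Proof.
move=> df e0.
have : (fun h : Cplx R =>
    h^-1 *: ((f \o shift z) (h *: (1 : Cplx R)) - f z)) @ 0^' --> 'D_1 f z.
  exact: df.
move=> /cvgrPdist_le /= /(_ (e%:C)%C).
have e0' : 0 < (e%:C)%C :> Cplx R by rewrite ltcE/= eqxx.
move=> /(_ e0').
rewrite !near_withinE => /near_CplxP[d d0 dP].
exists d => // h hd.
have [->|h0] := eqVneq h 0.
  by rewrite addr0 subrr mulr0 subr0 modC0 mulr0.
have := dP h; rewrite subr0 => /(_ hd h0).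
rewrite normCE lecE/= eqxx/= => H.
have -> : f (z + h) - f z - 'D_1 f z * h =
    - (h * ('D_1 f z - h^-1 *: ((f \o shift z) (h *: (1 : Cplx R)) - f z))).
  rewrite mulrBr -[h^-1 *: _]/(h^-1 * _) mulrA divff// mul1r opprB [h * _]mulrC.
  by rewrite /= /shift/= -[h *: 1]/(h * 1) mulr1 [h + z]addrC.
by rewrite modCN modCM mulrC ler_wpM2r// modC_ge0.
Qed.

Lemma derivable_near_modC {R : realType} (f : Cplx R -> Cplx R) (z : Cplx R)
    (e : R) : derivable f z 1 -> 0 < e ->
  \forall w \near z, modC (f w - f z) < e.
Proof.
move=> df e0; apply/near_CplxP.
have [d d0 dP] := derivable_CplxP _ _ _ df ltr01.
pose l := modC ('D_1 f z); have l0 : 0 <= l by exact: modC_ge0.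
have l1 : 0 < 1 + l by rewrite ltr_wpDr.
exists (Num.min d (e / (1 + l))); first by rewrite lt_min d0 divr_gt0.
move=> w; rewrite lt_min => /andP[wd we].
have := dP _ wd; rewrite [z + _]addrC subrK mul1r => H.
have -> : f w - f z = (f w - f z - 'D_1 f z * (w - z)) + 'D_1 f z * (w - z).
  by rewrite subrK.
apply: le_lt_trans (ler_modCD _ _) _; rewrite modCM -/l.
rewrite ltr_pdivlMr// in we.
by apply: le_lt_trans we; rewrite [_ * (1 + l)]mulrDr mulr1 [_ * l]mulrC lerD2r.
Qed.

(** * Meromorphic functions near their finite values *)

(** If the chart at z is 1/F, then 1/F does not vanish at z as F is finite
    there, and F is the inverse of a holomorphic function near z. *)
Lemma meromorphic_finite {R : realType} (F : Cplx R -> sphere R) (z : Cplx R) :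
  meromorphic F -> F z <> None ->
  (\forall w \near z, F w <> None) /\ derivable (@affine R \o F) z 1.
Proof.
move=> mF Fz.
have [Hz|Hz] := mF z.
  split; last by have [] := nbhs_singleton Hz.
  by apply: filterS Hz => w [].
have [sFz dg] := nbhs_singleton Hz.
set g := @affine R \o (@sinv R \o F) in Hz dg.
have gz0 : g z != 0.
  rewrite /g/=; move: sFz Fz; rewrite /=; case: (F z) => [a|//] /=.
  by case: eqVneq => // a0 _ _; rewrite /= invr_eq0.
have mg : 0 < modC (g z) by rewrite lt_neqAle modC_ge0 andbT eq_sym modC_eq0.
have gn : \forall w \near z, g w != 0.
  apply: filterS (derivable_near_modC _ _ _ dg mg) => w H.
  apply/eqP => gw; move: H; rewrite gw sub0r modCN ltxx.
  by [].
have Fg : \forall w \near z, F w <> None /\ (g w)^-1 = (@affine R \o F) w.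
  near=> w.
  have gw : g w != 0 by near: w.
  have : (@sinv R \o F) w <> None by near: w; apply: filterS Hz => w [].
  move: gw; rewrite /g/=; case: (F w) => [b|] /=; last by rewrite eqxx.
  by case: (eqVneq b 0) => [_ _ /(_ erefl)//|b0 _ _] /=; rewrite invrK.
split; first by apply: filterS Fg => w [].
apply: near_eq_derivable (derivableV gz0 dg).
by apply: filterS Fg => w [].
Unshelve. all: by end_near. Qed.

(** When u, z and v are aligned in this order, the last factor is the length of
    [u, v]: this is the local hypothesis of [cousin]. *)
Lemma derivable_straddle {R : realType} (f : Cplx R -> Cplx R) (z : Cplx R)
    (e : R) : derivable f z 1 -> 0 < e ->
  exists2 d : R, 0 < d & forall u v, modC (u - z) < d -> modC (v - z) < d ->
    modC (f v - f u) <= (modC ('D_1 f z) + e) * (modC (u - z) + modC (v - z)).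
Proof.
move=> df e0; have [d d0 dP] := derivable_CplxP _ _ _ df e0.
exists d => // u v ud vd.
have key w : modC (w - z) < d ->
    modC (f w - f z) <= (modC ('D_1 f z) + e) * modC (w - z).
  move=> wd; have := dP _ wd; rewrite [z + _]addrC subrK => H.
  have -> : f w - f z = 'D_1 f z * (w - z) + (f w - f z - 'D_1 f z * (w - z)).
    by rewrite [RHS]addrC subrK.
  by apply: le_trans (ler_modCD _ _) _; rewrite modCM mulrDl lerD2l.
apply: le_trans (ler_modC_dist _ (f z) _) _.
by rewrite [modC (f z - _)]modCB addrC [leRHS]mulrDr lerD// key.
Qed.

Lemma modC_segment {R : realType} (z w : Cplx R) (s t : R) :
  modC (z + (s%:C)%C * w - (z + (t%:C)%C * w)) = `|s - t| * modC w.
Proof.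
by rewrite opprD addrACA subrr add0r -mulrBl -rmorphB modCM modC_real.
Qed.

(** Increments of f from z to a nearby point are bounded by e times the length,
    for every e, because f' vanishes. *)
Lemma locally_constant {R : realType} (F : Cplx R -> sphere R) (z a : Cplx R) :
  meromorphic F ->
  (forall w, F w <> None -> 'D_1 (@affine R \o F) w = 0) ->
  F z = Some a -> \forall w \near z, F w = Some a.
Proof.
move=> mF D0 Fz; have Fz' : F z <> None by rewrite Fz.
have [/near_CplxP[d d0 dP] _] := meromorphic_finite _ _ mF Fz'.
apply/near_CplxP; exists d => // w wz.
pose g (t : R) : Cplx R := z + (t%:C)%C * (w - z).
set f := @affine R \o F.
have g0 : g 0 = z by rewrite /g mul0r addr0.
have g1 : g 1 = w by rewrite /g mul1r addrC subrK.
pose L := modC (w - z).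
have L0 : 0 <= L by exact: modC_ge0.
have gF t : 0 <= t <= 1 -> F (g t) <> None.
  move=> /andP[t0 t1]; apply: dP; rewrite -g0 modC_segment subr0 ger0_norm//.
  by apply: le_lt_trans wz; rewrite ler_piMl.
have fwz e : 0 < e -> modC (f w - f z) <= e * L.
  move=> e0.
  suff : modC (f (g 1) - f (g 0)) <= e * L * (1 - 0).
    by rewrite g0 g1 subr0 mulr1.
  apply: (@cousin R
    (fun s t => modC (f (g t) - f (g s)) <= e * L * (t - s))) => //.
    move=> t t01.
    have [_ df] := meromorphic_finite _ _ mF (gF _ t01).
    have [r r0 rP] := derivable_straddle _ _ _ df e0.
    have L1 : 0 < L + 1 by rewrite ltr_wpDl.
    exists (r / (L + 1)); first by rewrite divr_gt0.
    move=> u v _ ut tv _; rewrite ltrBlDr -ltrBlDl => tu.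
    rewrite -ltrBlDl => vt.
    have rL x : `|x - t| < r / (L + 1) -> modC (g x - g t) < r.
      rewrite modC_segment ltr_pdivlMr// => H; apply: le_lt_trans H.
      by rewrite ler_wpM2l// lerDl.
    apply: le_trans (rP _ _ _ _) _.
    - by apply: rL; rewrite distrC ger0_norm// subr_ge0.
    - by apply: rL; rewrite ger0_norm// subr_ge0.
    rewrite D0 ?modC0 ?add0r; last exact: gF.
    rewrite !modC_segment distrC !ger0_norm ?subr_ge0// -mulrDl.
    have -> : t - u + (v - t) = v - u by ring.
    by rewrite -/L -mulrA [_ * L]mulrC.
  move=> s t u _ _ st tu; apply: le_trans (ler_modC_dist _ (f (g t)) _) _.
  by apply: le_trans (lerD tu st) _; lra.
have : modC (f w - f z) <= 0.
  apply/ler_addgt0Pr => e e0; rewrite add0r.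
  have L1 : 0 < L + 1 by rewrite ltr_wpDl.
  apply: le_trans (fwz (e / (L + 1)) _) _; first by rewrite divr_gt0.
  by rewrite mulrAC ler_pdivrMr// ler_wpM2l ?ltW// ltrDl.
rewrite le_eqVlt ltNge modC_ge0 orbF modC_eq0 subr_eq0 /f/= Fz => /eqP.
have : F w <> None by exact: dP.
by case: (F w) => //= b _ ->.
Qed.

(** F is continuous as a map to the sphere; at a pole this is read in the chart
    1/F. *)
Lemma near_neq_value {R : realType} (F : Cplx R -> sphere R) (z a : Cplx R) :
  meromorphic F -> F z <> Some a -> \forall w \near z, F w <> Some a.
Proof.
move=> mF Fza; have [Fz|Fz] := pselect (F z = None).
  have [Hz|Hz] := mF z; first by have [] := nbhs_singleton Hz.
  have [_ dg] := nbhs_singleton Hz.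
  have [a0|a0] := eqVneq a 0.
    apply: filterS Hz => w [/= + _]; rewrite a0.
    by case: (F w) => // b + [bE]; rewrite bE/= eqxx.
  have ma : 0 < modC a^-1.
    by rewrite lt_neqAle modC_ge0 andbT eq_sym modC_eq0 invr_eq0.
  apply: filterS (derivable_near_modC _ _ _ dg ma) => w /=.
  by rewrite Fz/= subr0 => + Fw; rewrite Fw/= (negbTE a0)/= ltxx.
have [_ df] := meromorphic_finite _ _ mF Fz.
have ma : 0 < modC (affine (F z) - a).
  rewrite lt_neqAle modC_ge0 andbT eq_sym modC_eq0 subr_eq0.
  by apply/eqP => E; apply: Fza; move: E Fz; case: (F z) => //= b ->.
apply: filterS (derivable_near_modC _ _ _ df ma) => w /=.
by move=> + Fw; rewrite Fw /= modCB ltxx.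
Qed.

(** If f' vanishes wherever F is finite, the set where F takes a given finite
    value is open and closed.  This is applied along the segment from a point
    where F is finite to an arbitrary one; the poles on this segment belong to
    the open set where F differs from the given value. *)
Lemma nonconstant_derive_neq0 {R : realType} (F : Cplx R -> sphere R) :
  meromorphic F -> ~ (exists c : sphere R, forall z, F z = c) ->
  exists2 z, F z <> None & 'D_1 (@affine R \o F) z != 0.
Proof.
move=> mF ncF; apply: contrapT => H; apply: ncF.
have D0 w : F w <> None -> 'D_1 (@affine R \o F) w = 0.
  move=> Fw; apply: contrapT => /eqP Dw; apply: H.
  by exists w.
have [[z0 Fz0]|N] := pselect (exists z, F z <> None); last first.
  by exists None => z; apply: contrapT => Fz; apply: N; exists z.
case Fz0E : (F z0) Fz0 => [a|//] _.
exists (Some a) => z1.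
pose g (t : R) : Cplx R := z0 + (t%:C)%C * (z1 - z0).
have g0 : g 0 = z0 by rewrite /g mul0r addr0.
have g1 : g 1 = z1 by rewrite /g mul1r addrC subrK.
pose L := modC (z1 - z0).
have L0 : 0 <= L by exact: modC_ge0.
have L1 : 0 < L + 1 by rewrite ltr_wpDl.
suff : F (g 0) = Some a -> F (g 1) = Some a by rewrite g0 g1; apply.
apply: (@cousin R (fun s t => F (g s) = Some a -> F (g t) = Some a)) => //;
  last first.
  by move=> s t u _ _ st tu /st /tu.
move=> t _.
have rL r x : 0 < r -> `|x - t| < r / (L + 1) -> modC (g x - g t) < r.
  move=> r0; rewrite modC_segment ltr_pdivlMr// => E; apply: le_lt_trans E.
  by rewrite ler_wpM2l// lerDl.
have [Ft|Ft] := pselect (F (g t) = Some a).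
  have /near_CplxP[r r0 rP] := locally_constant _ _ _ mF D0 Ft.
  exists (r / (L + 1)); first by rewrite divr_gt0.
  move=> u v _ ut tv _ tu vt _; apply/rP/rL => //.
  by rewrite ger0_norm ?subr_ge0// ltrBlDl.
have /near_CplxP[r r0 rP] := near_neq_value _ _ _ mF Ft.
exists (r / (L + 1)); first by rewrite divr_gt0.
move=> u v _ ut tv _ tu vt Fu; exfalso; apply: (rP (g u)) => //.
by apply: rL => //; rewrite distrC ger0_norm ?subr_ge0// ltrBlDr -ltrBlDl.
Qed.

(** * The spherical distance and the affine coordinate *)

(** The scalar product of the stereographic images of a and b is
    1 - 2 |b - a|^2 / ((1 + |b|^2) (1 + |a|^2)). *)
Lemma rho_affine {R : realType} (a b : Cplx R) :
  rho (Some b : sphere R) (Some a) =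
  acos (1 - 2 * modC (b - a) ^+ 2 /
            ((1 + modC b ^+ 2) * (1 + modC a ^+ 2))) / 2.
Proof.
rewrite /rho /=; congr (acos _ / 2).
case: a b => [a1 a2] [b1 b2]; rewrite !sqr_modC /=.
by field; rewrite !gt_eqF// ltr_wpDr// addr_ge0// sqr_ge0.
Qed.

Lemma rho_infty_affine {R : realType} (a : Cplx R) :
  rho (None : sphere R) (Some a) = acos (1 - 2 / (1 + modC a ^+ 2)) / 2.
Proof.
rewrite /rho /=; congr (acos _ / 2).
by field; rewrite gt_eqF// ltr_wpDr// sqr_ge0.
Qed.

Lemma acos_lt_inv {R : realType} (x y : R) :
  -1 <= x <= 1 -> -1 <= y <= 1 -> acos x < acos y -> y < x.
Proof.
move=> x1 y1 xy; rewrite -(acosK (x := x)) ?in_itv//= -[y]acosK ?in_itv//=.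
by rewrite ltr_cos// in_itv/= acos_ge0 ?acos_lepi.
Qed.

Lemma chordal_le1 {R : realType} (a b : Cplx R) :
  0 <= modC (b - a) ^+ 2 / ((1 + modC b ^+ 2) * (1 + modC a ^+ 2)) <= 1.
Proof.
have p0 (z : Cplx R) : 0 < 1 + modC z ^+ 2 by rewrite ltr_wpDr// sqr_ge0.
have pp := mulr_gt0 (p0 b) (p0 a).
apply/andP; split; first by apply: divr_ge0; [exact: sqr_ge0|exact: ltW].
rewrite ler_pdivrMr// mul1r.
case: a b {p0 pp} => [a1 a2] [b1 b2]; rewrite !sqr_modC /=.
have := sqr_ge0 (a1 * b1 + a2 * b2 + 1); have := sqr_ge0 (a1 * b2 - a2 * b1).
rewrite !expr2; nra.
Qed.

Lemma rho_le_pi {R : realType} (p : sphere R) (a : Cplx R) :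
  rho p (Some a) <= pi / 2.
Proof.
case: p => [b|]; rewrite ?rho_affine ?rho_infty_affine ler_pM2r ?invr_gt0//.
  have := chordal_le1 a b; rewrite -mulrA; set D := _ / _ => /andP[D0 D1].
  by apply: acos_lepi; apply/andP; split; lra.
have i1 : (1 + modC a ^+ 2)^-1 <= 1.
  by rewrite invf_le1 ?lerDl ?sqr_ge0// ltr_wpDr// sqr_ge0.
have i0 : 0 < (1 + modC a ^+ 2)^-1 by rewrite invr_gt0 ltr_wpDr// sqr_ge0.
by apply: acos_lepi; apply/andP; split; lra.
Qed.

(** On a bounded set the spherical distance controls the Euclidean distance,
    uniformly, and keeps away from infinity. *)
Lemma rho_lt_affine {R : realType} (M e : R) : 0 < e ->
  exists2 eps : R, 0 < eps & forall (a : Cplx R) (q : sphere R),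
    modC a <= M -> rho q (Some a) < eps ->
    exists2 b, q = Some b & modC (b - a) < e.
Proof.
move=> e0; pose K : R := 1 + M ^+ 2.
have K1 : 1 <= K by rewrite lerDl sqr_ge0.
(* In the denominator |b|^2 <= 2 |a|^2 + 2 |b - a|^2; the first bound absorbs
   the last term, the second one makes |b - a| less than e. *)
pose eta : R := Num.min (1 / (2 * K)) (e ^+ 2 / (K * (1 + 2 * M ^+ 2))).
have K0 : 0 < K by exact: lt_le_trans K1.
have M0 : 0 < 1 + 2 * M ^+ 2 by rewrite ltr_wpDr// mulr_ge0// sqr_ge0.
have eta0 : 0 < eta by rewrite lt_min !divr_gt0// ?mulr_gt0// exprn_gt0.
have etaK : eta * K <= 1 / 2.
  apply: (@le_trans _ _ (1 / (2 * K) * K)).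
    by apply: ler_wpM2r; [exact: ltW|rewrite ge_min lexx].
  by rewrite !div1r invfM -mulrA mulVf ?gt_eqF// mulr1.
have etae : eta * K * (1 + 2 * M ^+ 2) <= e ^+ 2.
  apply: (@le_trans _ _
    (e ^+ 2 / (K * (1 + 2 * M ^+ 2)) * (K * (1 + 2 * M ^+ 2)))).
    rewrite -mulrA; apply: ler_wpM2r; first by rewrite ltW// mulr_gt0.
    by rewrite ge_min lexx orbT.
  by rewrite divfK// gt_eqF// mulr_gt0.
have eta1 : eta <= 1 / 2 by apply: le_trans etaK; rewrite ler_peMr// ltW.
exists (acos (1 - eta) / 2).
  by rewrite divr_gt0// acos_gt0//; apply/andP; split; lra.
move=> a [b|] aM; rewrite ?rho_affine ?rho_infty_affine ltr_pM2r ?invr_gt0//.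
  have := chordal_le1 a b; rewrite -mulrA; set D := _ / _ => /andP[D0 D1] H.
  exists b => //.
  have {H} : 1 - eta < 1 - 2 * D.
    by apply: acos_lt_inv H; apply/andP; split; lra.
  rewrite ltrD2l ltrN2 => H.
  rewrite ltNge; apply/negP => eD.
  have q0 (z : Cplx R) : 0 < 1 + modC z ^+ 2 by rewrite ltr_wpDr// sqr_ge0.
  have DE : D * ((1 + modC b ^+ 2) * (1 + modC a ^+ 2)) = modC (b - a) ^+ 2.
    by rewrite divfK// gt_eqF// mulr_gt0.
  have ma0 := modC_ge0 a; have mb0 := modC_ge0 b; have mba0 := modC_ge0 (b - a).
  have mb : modC b <= modC a + modC (b - a).
    by rewrite -[X in modC X <= _](subrK a) addrC ler_modCD.
  have aM2 : 1 + modC a ^+ 2 <= K.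
    by rewrite lerD2l -[leRHS]/(M ^+ 2) ler_pXn2r// ?nnegrE// (le_trans ma0).
  have bM2 : 1 + modC b ^+ 2 <= 1 + 2 * M ^+ 2 + 2 * modC (b - a) ^+ 2.
    rewrite -addrA lerD2l.
    apply: (@le_trans _ _ ((modC a + modC (b - a)) ^+ 2)).
      by rewrite ler_pXn2r// nnegrE addr_ge0.
    have : modC a ^+ 2 <= M ^+ 2 by rewrite -(lerD2l 1).
    have := sqr_ge0 (modC a - modC (b - a)); rewrite !expr2; lra.
  have e2D : e ^+ 2 <= modC (b - a) ^+ 2 by rewrite ler_pXn2r// nnegrE ltW.
  set S := modC (b - a) ^+ 2 in DE bM2 e2D.
  have : 2 * S < eta * ((1 + 2 * M ^+ 2 + 2 * S) * K).
    apply: (@lt_le_trans _ _ (eta * ((1 + modC b ^+ 2) * (1 + modC a ^+ 2)))).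
      by rewrite -DE [ltLHS]mulrA ltr_pM2r// mulr_gt0.
    rewrite ler_pM2l//; apply: ler_pM => //; exact: ltW.
  have S0 : 0 <= S by exact: sqr_ge0.
  have : eta * K * (2 * S) <= 1 / 2 * (2 * S) by rewrite ler_wpM2r// mulr_ge0.
  have -> : eta * ((1 + 2 * M ^+ 2 + 2 * S) * K) =
      eta * K * (1 + 2 * M ^+ 2) + eta * K * (2 * S) by ring.
  lra.
move=> H; exfalso.
have q0 : 0 < 1 + modC a ^+ 2 by rewrite ltr_wpDr// sqr_ge0.
have i1 : (1 + modC a ^+ 2)^-1 <= 1 by rewrite invf_le1// lerDl sqr_ge0.
have i0 : 0 < (1 + modC a ^+ 2)^-1 by rewrite invr_gt0.
have : 1 - eta < 1 - 2 / (1 + modC a ^+ 2).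
  by apply: acos_lt_inv H; apply/andP; split; lra.
rewrite ltrD2l ltrN2 ltr_pdivrMr// => H'.
have aM2 : 1 + modC a ^+ 2 <= K.
  by rewrite lerD2l ler_pXn2r// ?nnegrE ?modC_ge0// (le_trans (modC_ge0 a)).
have : eta * (1 + modC a ^+ 2) <= eta * K by rewrite ler_pM2l.
lra.
Qed.

(** * Recurrence in the affine coordinate *)

Lemma compact_rectangle {R : realType} (a b c d : R) :
  compact [set z : Cplx R | a <= complex.Re (z : R[i]) <= b /\
                            c <= complex.Im (z : R[i]) <= d].
Proof.
pose g (p : R * R) : Cplx R := (p.1 +i* p.2)%C.
have cg : continuous g.
  move=> p; apply/cvgrPdist_lt => /= e e0.
  have eE : ((complex.Re (e : R[i]))%:C)%C = e.
    by move: e0; case: (e) => x y; rewrite ltcE/= => /andP[/eqP ->].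
  set r := complex.Re (e : R[i]) in eE.
  have r0 : 0 < r by move: e0; rewrite -eE ltcE/= => /andP[].
  have r2 : 0 < r / 2 by rewrite divr_gt0.
  exists (ball p.1 (r / 2), ball p.2 (r / 2)) => /=.
    by split; apply: nbhsx_ballx.
  move=> q [/= q1 q2].
  rewrite -[ltRHS]eE normCE ltcE/= eqxx/=.
  apply: le_lt_trans (ler_modC_Re_Im _) _ => /=.
  move: q1 q2; rewrite /ball/= => q1 q2.
  by apply: lt_le_trans (ltrD q1 q2) _; lra.
have -> : [set z : Cplx R | a <= complex.Re (z : R[i]) <= b /\
    c <= complex.Im (z : R[i]) <= d] = g @` (`[a, b] `*` `[c, d]).
  apply/seteqP; split.
    by move=> [x y] /= [xab ycd]; exists (x, y) => //=; rewrite !in_itv/=.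
  by move=> _ [[x y] /= [+ +] <-] /=; rewrite !in_itv.
apply: continuous_compact; first exact: continuous_subspaceT.
by apply: compact_setX; exact: segment_compact.
Qed.

Lemma recurrence_affine {R : realType} (F : Cplx R -> sphere R)
    (K : set (Cplx R)) (M e : R) :
  locally_uniformly_recurrent F -> compact K ->
  (forall z, K z -> F z <> None /\ modC (affine (F z)) <= M) -> 0 < e ->
  exists2 L : R, 0 < L & forall a : Cplx R, exists2 w, modC (w - a) < L &
    forall z, K z -> F (z + w) <> None /\
      modC (affine (F (z + w)) - affine (F z)) < e.
Proof.
move=> recF cK FK e0.
have [eps eps0 epsP] := rho_lt_affine M e e0.
have [L0 [_ L0P]] := recF eps K eps0 cK.
exists (Num.max 1 (L0 + 1)); first by rewrite lt_max ltr01.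
move=> a; have [|w /= ws wa] := L0P (Num.max 1 (L0 + 1)) _ a.
  by rewrite lt_max ltrDl ltr01 orbT.
exists w => // z Kz.
have [Fz zM] := FK z Kz.
have : rho (F (z + w)) (F z) < eps.
  apply: le_lt_trans ws; apply: ub_le_sup; last by exists z.
  exists (pi / 2) => _ [y Ky <-]; have [Fy _] := FK y Ky.
  by case: (F y) Fy => // b _; exact: rho_le_pi.
case: (F z) Fz zM => //= b _ bM /(epsP _ _ bM)[c -> cb].
by split.
Qed.

(** * Measurability in the plane *)

Definition planeC {R : realType} (p : R * R) : Cplx R := (p.1 +i* p.2)%C.

(** An open set of the plane is a countable union of squares with rational
    centers and sizes 1 / n. *)
Lemma measurable_plane_open {R : realType} (U : set (R * R)) :
  (forall q, U q -> exists2 d : R, 0 < d & forall q', `|q'.1 - q.1| < d ->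
     `|q'.2 - q.2| < d -> U q') -> measurable U.
Proof.
move=> oU.
pose B (a b : rat) (n : nat) : set (R * R) :=
  `](ratr a - n.+1%:R^-1), (ratr a + n.+1%:R^-1)[ `*`
  `](ratr b - n.+1%:R^-1), (ratr b + n.+1%:R^-1)[.
pose C a b n := if `[< B a b n `<=` U >] then B a b n else set0.
have -> : U = \bigcup_a \bigcup_b \bigcup_n C a b n.
  apply/seteqP; split; last first.
    by move=> q [a _ [b _ [n _]]]; rewrite /C; case: asboolP => // BU /BU.
  move=> [/= x y] Uxy; have [d d0 /= dU] := oU _ Uxy.
  pose n := Num.truncn (2 / d).
  have n0 : 0 < n.+1%:R^-1 :> R by rewrite invr_gt0.
  have nd : 2 * n.+1%:R^-1 < d.
    by rewrite ltr_pdivrMr// mulrC -ltr_pdivrMr// truncnS_gt.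
  set r : R := n.+1%:R^-1 in n0 nd *.
  have rat_near (t : R) : exists a : rat, `|t - ratr a| < r.
    have /rat_in_itvoo[a] : t - r < t + r.
      by rewrite ltrBlDr -addrA ltrDl addr_gt0.
    rewrite in_itv/= => /andP[a1 a2]; exists a.
    by rewrite ltr_norml; apply/andP; split; lra.
  have [a xa] := rat_near x; have [b yb] := rat_near y.
  exists a => //; exists b => //; exists n => //.
  rewrite /C; case: asboolP => [_|].
    rewrite /B -/r.
    move: xa yb; rewrite !ltr_norml => /andP[? ?] /andP[? ?].
    by split => /=; rewrite in_itv/=; apply/andP; split; lra.
  case=> -[x' y']; rewrite /B -/r => -[/=].
  rewrite !in_itv/= => /andP[? ?] /andP[? ?].
  move: xa yb; rewrite !ltr_norml => /andP[? ?] /andP[? ?].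
  by apply: dU => /=; rewrite ltr_norml; apply/andP; split; lra.
apply: bigcupT_measurable_rat => a; apply: bigcupT_measurable_rat => b.
apply: bigcupT_measurable => n; rewrite /C; case: ifP => // _.
by apply: measurableX; exact: measurable_itv.
Qed.

(** The hypotheses say that U is open and u continuous on U, so that the
    superlevel sets of u in U are open. *)
Lemma measurable_fun_plane {R : realType} (U : set (R * R)) (u : R * R -> R) :
  (forall q, U q -> exists2 d : R, 0 < d & forall q', `|q'.1 - q.1| < d ->
     `|q'.2 - q.2| < d -> U q') ->
  (forall q (e : R), U q -> 0 < e -> exists2 d : R, 0 < d & forall q',
     `|q'.1 - q.1| < d -> `|q'.2 - q.2| < d -> `|u q' - u q| < e) ->
  measurable_fun U u.
Proof.
move=> oU cu; apply: (measurability _ (RGenOInfty.measurableE R)).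
move=> _ [_ [a ->] <-]; apply: measurable_plane_open => q [/= Uq].
rewrite in_itv/= andbT => aq.
have [d1 d10 d1U] := oU _ Uq.
have [|d2 d20 d2u] := cu q (u q - a) Uq; first by rewrite subr_gt0.
exists (Num.min d1 d2); first by rewrite lt_min d10.
move=> q'; rewrite !lt_min => /andP[x1 x2] /andP[y1 y2].
split; first exact: d1U.
rewrite /= in_itv/= andbT.
by move: (d2u _ x2 y2); rewrite ltr_norml => /andP[? ?]; lra.
Qed.

Lemma planeC_dist {R : realType} (p q : R * R) (d : R) :
  `|q.1 - p.1| < d / 2 -> `|q.2 - p.2| < d / 2 ->
  modC (planeC q - planeC p) < d.
Proof.
move=> x y; apply: le_lt_trans (ler_modC_Re_Im _) _ => /=.
by apply: lt_le_trans (ltrD x y) _; lra.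
Qed.

Section affine_measurability.
Context {R : realType} (F : Cplx R -> sphere R) (mF : meromorphic F).
Let f : Cplx R -> Cplx R := @affine R \o F.
Let U : set (R * R) := [set p | F (planeC p) <> None].

Let nearU q : U q -> exists2 d : R, 0 < d & forall q', `|q'.1 - q.1| < d ->
     `|q'.2 - q.2| < d -> U q'.
Proof.
move=> Uq; have [/near_CplxP[d d0 dP] _] := meromorphic_finite _ _ mF Uq.
exists (d / 2); first by rewrite divr_gt0.
by move=> q' x y; apply: dP; exact: planeC_dist.
Qed.

Lemma measurable_finite_points : measurable U.
Proof. exact: measurable_plane_open. Qed.

Let measurable_part (g : Cplx R -> R) :
  (forall z w, `|g z - g w| <= modC (z - w)) -> g 0 = 0 ->
  measurable_fun setT (fun p : R * R => g (f (planeC p))).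
Proof.
move=> gl g0.
have -> : (fun p : R * R => g (f (planeC p))) =
    (fun p : R * R => g (f (planeC p))) \_ U.
  apply/funext => p; rewrite patchE; case: ifPn => // /negP/negP.
  by rewrite notin_setE /U/= => /contrapT Fp; rewrite /f/= Fp.
apply/(measurable_restrictT _ measurable_finite_points).
apply: measurable_fun_plane => // q e Uq e0.
have [_ df] := meromorphic_finite _ _ mF Uq.
have /near_CplxP[d d0 dP] := derivable_near_modC _ _ _ df e0.
exists (d / 2); first by rewrite divr_gt0.
move=> q' x y; apply: le_lt_trans (gl _ _) _.
by apply: dP; exact: planeC_dist.
Qed.

(** f' is the pointwise limit of the difference quotients with step 1 / (n + 1)
    in the horizontal direction.  These are measurable on the whole plane, since
    f is 0 at the poles and continuous elsewhere. *)
Lemma measurable_sqr_derive :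
  measurable_fun U (fun p : R * R => modC ('D_1 f (planeC p)) ^+ 2).
Proof.
pose Re (z : Cplx R) : R := complex.Re (z : R[i]).
pose Im (z : Cplx R) : R := complex.Im (z : R[i]).
have mRe : measurable_fun setT (fun p : R * R => Re (f (planeC p))).
  apply: measurable_part => // z w; apply: le_trans (ler_Re_modC _).
  by rewrite /Re; case: z w => [? ?] [? ?].
have mIm : measurable_fun setT (fun p : R * R => Im (f (planeC p))).
  apply: measurable_part => // z w; apply: le_trans (ler_Im_modC _).
  by rewrite /Im; case: z w => [? ?] [? ?].
pose sh (n : nat) (p : R * R) : R * R := (p.1 + n.+1%:R^-1, p.2).
have msh n : measurable_fun setT (sh n).
  apply: measurable_fun_pair; last exact: measurable_snd.
  by apply: measurable_funD => //; exact: measurable_fst.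
pose h n (p : R * R) := n.+1%:R ^+ 2 *
  ((Re (f (planeC (sh n p))) - Re (f (planeC p))) ^+ 2 +
   (Im (f (planeC (sh n p))) - Im (f (planeC p))) ^+ 2).
apply: (@measurable_fun_cvg _ _ _ _ h).
  move=> n; apply: measurable_funTS; apply: measurable_funM => //.
  apply: measurable_funD; apply: measurable_funX; apply: measurable_funB => //.
    exact: (measurableT_comp mRe (msh n)).
  exact: (measurableT_comp mIm (msh n)).
move=> p Up.
have [_ df] := meromorphic_finite _ _ mF Up.
pose m n := n.+1%:R * modC (f (planeC (sh n p)) - f (planeC p)).
have hE n : h n p = m n * m n.
  rewrite -expr2 exprMn sqr_modC /h /Re /Im.
  by case: (f (planeC (sh n p))) (f (planeC p)) => [? ?] [? ?].
rewrite (funext hE) expr2.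
suff cm : m @ \oo --> modC ('D_1 f (planeC p)) by exact: cvgM.
apply/cvgrPdist_le => e e0.
have [d d0 dP] := derivable_CplxP _ _ _ df e0.
near=> n.
have nd : n.+1%:R^-1 < d by near: n; exact: (near_infty_natSinv_lt (PosNum d0)).
set r : R := n.+1%:R^-1 in nd.
have r0 : 0 < r by rewrite invr_gt0.
have nr : n.+1%:R * r = 1 by rewrite divff.
have shE : planeC (sh n p) = planeC p + (r%:C)%C.
  by rewrite /planeC /sh -/r /=; congr Complex; rewrite addr0.
have := dP (r%:C)%C; rewrite modC_real (ger0_norm (ltW r0)) => /(_ nd).
rewrite -shE => H.
set D := 'D_1 f (planeC p) in H *.
have D_r : n.+1%:R * modC (D * (r%:C)%C) = modC D.
  by rewrite modCM modC_real (ger0_norm (ltW r0)) mulrCA nr mulr1.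
have eE : e = n.+1%:R * (e * r) by rewrite mulrCA nr mulr1.
rewrite -D_r /m -mulrBr normrM ger0_norm// [leRHS]eE ler_pM2l//.
apply: le_trans H.
set A := f _ - f _; set B := D * _.
have h1 : modC B <= modC A + modC (A - B).
  by rewrite [modC (A - B)]modCB -{1}(subrK A B) addrC ler_modCD.
have h2 : modC A <= modC B + modC (A - B).
  by rewrite -{1}(subrK B A) addrC ler_modCD.
by rewrite ler_norml; apply/andP; split; lra.
Unshelve. all: by end_near. Qed.
End affine_measurability.

(** * The energy of a square *)

Lemma measurable_sqr_derive_segment {R : realType} (F : Cplx R -> sphere R)
    (a b y : R) : meromorphic F ->
  (forall x, a <= x <= b -> F (planeC (x, y)) <> None) ->
  measurable_fun `[a, b]
    (fun x => modC ('D_1 (@affine R \o F) (planeC (x, y))) ^+ 2).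
Proof.
move=> mF Fx.
pose G (p : R * R) := modC ('D_1 (@affine R \o F) (planeC p)) ^+ 2.
apply: (@measurable_comp _ _ _ _ _ _ _ G _ (fun x : R => (x, y))
  (measurable_finite_points F mF) _ (measurable_sqr_derive F mF)).
  by move=> q [x /= + <-]; rewrite in_itv/= => /Fx.
by apply: measurable_funTS; exact: pair2_measurable.
Qed.

Lemma segment_energy {R : realType} (F : Cplx R -> sphere R) (x0 y h e : R) :
  meromorphic F -> 0 < h -> 0 < e ->
  (forall x, x0 <= x <= x0 + h -> F (planeC (x, y)) <> None) ->
  e <= modC (affine (F (planeC (x0 + h, y))) - affine (F (planeC (x0, y)))) ->
  ((e ^+ 2 / h)%:E <= \int[lebesgue_measure]_(x in `[x0, (x0 + h)%R])
     (modC ('D_1 (@affine R \o F) (planeC (x, y))) ^+ 2)%:E)%E.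
Proof.
move=> mF h0 e0 Fx eF.
pose f := @affine R \o F.
have distE (x x' : R) : modC (planeC (x, y) - planeC (x', y)) = `|x - x'|.
  by rewrite modCE /= subrr expr0n addr0 sqrtr_sqr.
have := @energy_le_integral R
  (fun u v => modC (f (planeC (v, y)) - f (planeC (u, y))))
  (fun x => modC ('D_1 f (planeC (x, y))) ^+ 2) x0 (x0 + h) e.
rewrite [x0 + h - x0](_ : _ = h); last by ring.
apply => //.
- by rewrite ltrDl.
- by move=> u v w _ _; rewrite [leRHS]addrC ler_modC_dist.
- exact: measurable_sqr_derive_segment.
- by move=> x _; rewrite sqr_ge0.
move=> x d xab d0.
have [_ df] := meromorphic_finite _ _ mF (Fx _ xab).
have [r r0 rP] := derivable_straddle _ _ _ df d0.
exists r => // u v _ ux xv _ ur vr.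
have uE : modC (planeC (u, y) - planeC (x, y)) = x - u.
  by rewrite distE distrC ger0_norm// subr_ge0.
have vE : modC (planeC (v, y) - planeC (x, y)) = v - x.
  by rewrite distE ger0_norm// subr_ge0.
have := rP (planeC (u, y)) (planeC (v, y)).
rewrite uE vE sqrtr_sqr (ger0_norm (modC_ge0 _)).
have -> : x - u + (v - x) = v - u by ring.
by apply; lra.
Qed.

(** Tonelli: integrate the energy e^2 / h of the horizontal segments over an
    interval of ordinates of length h. *)
Lemma square_energy {R : realType} (F : Cplx R -> sphere R) (x0 y0 h e : R)
    (Q := (`[x0, x0 + h] `*` `[y0, y0 + h])%classic : set (R * R)) :
  meromorphic F -> 0 < h -> 0 < e ->
  (forall q, Q q -> F (planeC q) <> None) ->
  (forall y, y0 <= y <= y0 + h -> e <=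
     modC (affine (F (planeC (x0 + h, y))) - affine (F (planeC (x0, y))))) ->
  ((e ^+ 2)%:E <= \int[lebesgue_measure \x lebesgue_measure]_(q in Q)
     (modC ('D_1 (@affine R \o F) (planeC q)) ^+ 2)%:E)%E.
Proof.
move=> mF h0 e0 FQ eF.
have QE (x y : R) : Q (x, y) = (x0 <= x <= x0 + h /\ y0 <= y <= y0 + h).
  by rewrite /Q /setX /=; rewrite !in_itv.
have mQ : measurable Q by apply: measurableX; exact: measurable_itv.
pose g (q : R * R) : \bar R :=
  (modC ('D_1 (@affine R \o F) (planeC q)) ^+ 2)%:E.
have g0 q : (0 <= g q)%E by rewrite lee_fin sqr_ge0.
have mg : measurable_fun Q g.
  apply/measurable_EFinP; apply: measurable_funS (measurable_sqr_derive F mF).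
    exact: measurable_finite_points.
  by move=> q /FQ.
rewrite integral_mkcond fubini_tonelli2//; last 2 first.
- exact/(measurable_restrictT _ mQ).
- by move=> q; apply: erestrict_ge0 => ? _; exact: g0.
have -> : e ^+ 2 = (e ^+ 2 / h) * h by rewrite divfK// gt_eqF.
have muI : lebesgue_measure (`[y0, y0 + h]%classic : set R) = h%:E.
  by rewrite lebesgue_measure_itv/= lte_fin ltrDl h0 -EFinD addrAC subrr add0r.
rewrite EFinM -muI.
have := @cst_le_integral _ _ _ (@lebesgue_measure R) `[y0, y0 + h] setT
  (e ^+ 2 / h) (fubini_G lebesgue_measure (g \_ Q)).
apply => //.
- by rewrite divr_ge0 ?sqr_ge0// ltW.
- move=> y _; apply: integral_ge0 => x _.
  by apply: erestrict_ge0 => ? _; exact: g0.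
move=> y /=; rewrite in_itv/= => yI.
rewrite /fubini_G.
apply: (@le_trans _ _
  (\int[lebesgue_measure]_(x in `[x0, (x0 + h)%R]) g (x, y))%E).
  apply: segment_energy => //; last exact: eF.
  by move=> x xI; apply: FQ; rewrite QE.
apply: ge0_le_integral_lower => //.
  by move=> x _; apply: erestrict_ge0 => ? _; exact: g0.
by move=> x /=; rewrite in_itv/= => xI; rewrite g0 patchE mem_set/= ?lexx.
Qed.

Lemma spherical_derivative_ge {R : realType} (F : Cplx R -> sphere R)
    (z : Cplx R) (B : R) : F z <> None -> modC (affine (F z)) <= B ->
  modC ('D_1 (@affine R \o F) z) ^+ 2 / (1 + B ^+ 2) ^+ 2 <=
  spherical_derivative F z ^+ 2.
Proof.
move=> Fz FB.
have B0 : 0 <= B by apply: le_trans FB; exact: modC_ge0.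
have -> : spherical_derivative F z = spherical_derivative_finite F z.
  by rewrite /spherical_derivative; case: (F z) Fz.
rewrite /spherical_derivative_finite exprMn ler_wpM2l ?sqr_ge0//.
rewrite -exprVn ler_pXn2r ?nnegrE ?invr_ge0 ?addr_ge0 ?sqr_ge0//.
rewrite lef_pV2 ?posrE//; first by rewrite lerD2l ler_pXn2r// nnegrE modC_ge0.
  by rewrite ltr_wpDr// sqr_ge0.
by rewrite ltr_wpDr// sqr_ge0.
Qed.

(** * Oscillation recurs in every large square *)

Lemma planeCD {R : realType} (x y : R) (w : Cplx R) :
  planeC (x, y) + w =
  planeC (x + complex.Re (w : R[i]), y + complex.Im (w : R[i])).
Proof. by case: w. Qed.

(** Near a point z0 where l = |f'(z0)| > 0 the difference between f and its
    affine approximation is at most l / 8 times the distance to z0, so f moves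
    by at least l h - 3 l h / 8 over a horizontal segment of length h. *)
Lemma oscillating_square {R : realType} (F : Cplx R -> sphere R) :
  meromorphic F -> ~ (exists c : sphere R, forall z, F z = c) ->
  exists x0 y0 h e M : R, [/\ 0 < h, 0 < e,
    forall x y, x0 <= x <= x0 + h -> y0 <= y <= y0 + h ->
      F (planeC (x, y)) <> None /\ modC (affine (F (planeC (x, y)))) <= M &
    forall y, y0 <= y <= y0 + h -> 3 * e <=
      modC (affine (F (planeC (x0 + h, y))) - affine (F (planeC (x0, y))))].
Proof.
move=> mF ncF; have [z0 Fz0 D0] := nonconstant_derive_neq0 _ mF ncF.
have [/near_CplxP[d1 d10 d1P] df] := meromorphic_finite _ _ mF Fz0.
set f := @affine R \o F in df D0.
pose l := modC ('D_1 f z0).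
have l0 : 0 < l by rewrite lt_neqAle modC_ge0 andbT eq_sym modC_eq0.
have l8 : 0 < l / 8 by rewrite divr_gt0.
have [d2 d20 d2P] := derivable_CplxP _ _ _ df l8.
pose h : R := Num.min d1 d2 / 4.
have h0 : 0 < h by rewrite divr_gt0// lt_min d10.
have h1 : 4 * h <= d1 by rewrite mulrC divfK// ge_min lexx.
have h2 : 4 * h <= d2 by rewrite mulrC divfK// ge_min lexx orbT.
pose x0 := complex.Re (z0 : R[i]); pose y0 := complex.Im (z0 : R[i]).
have z0E : z0 = planeC (x0, y0) by rewrite /x0 /y0; case: (z0).
have small (s t : R) : 0 <= s <= h -> 0 <= t <= h ->
    modC (planeC (s, t)) <= s + t.
  move=> /andP[s0 _] /andP[t0 _]; apply: le_trans (ler_modC_Re_Im _) _.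
  by rewrite /= !ger0_norm.
have addE s t : planeC (x0 + s, y0 + t) = z0 + planeC (s, t) by rewrite z0E.
have key (s t : R) : 0 <= s <= h -> 0 <= t <= h ->
    F (planeC (x0 + s, y0 + t)) <> None /\
    modC (f (planeC (x0 + s, y0 + t)) - f z0 - 'D_1 f z0 * planeC (s, t)) <=
    l / 8 * (s + t).
  move=> sh th; have st := small s t sh th.
  have st4 : modC (planeC (s, t)) < 4 * h.
    by apply: le_lt_trans st _; case/andP: sh; case/andP: th; lra.
  rewrite addE; split.
    by apply: d1P; rewrite addrAC subrr add0r; exact: lt_le_trans h1.
  apply: le_trans (d2P _ _) _; first exact: lt_le_trans h2.
  by rewrite ler_pM2l.
exists x0, y0, h, (l * h / 8), (modC (f z0) + 4 * l * h); split => //.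
- by rewrite divr_gt0// mulr_gt0.
- move=> x y xI yI.
  have sI : 0 <= x - x0 <= h by case/andP: xI => ? ?; apply/andP; split; lra.
  have tI : 0 <= y - y0 <= h by case/andP: yI => ? ?; apply/andP; split; lra.
  have := key _ _ sI tI; rewrite !subrKC => -[Fxy H]; split => //.
  have st := small _ _ sI tI.
  set p := planeC (x, y) in H *; set q := planeC (_, _) in H st.
  have -> : affine (F p) =
      f z0 + ((f p - f z0 - 'D_1 f z0 * q) + 'D_1 f z0 * q).
    by rewrite subrK addrC subrK.
  apply: le_trans (ler_modCD _ _) _; rewrite lerD2l.
  apply: le_trans (ler_modCD _ _) _; rewrite modCM -/l.
  have : l * modC q <= l * (2 * h).
    rewrite ler_pM2l//; apply: le_trans st _.
    by case/andP: sI; case/andP: tI; lra.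
  have : l / 8 * (x - x0 + (y - y0)) <= l / 8 * (2 * h).
    by rewrite ler_pM2l//; case/andP: sI; case/andP: tI; lra.
  have : 0 < l * h by rewrite mulr_gt0.
  lra.
move=> y yI.
have tI : 0 <= y - y0 <= h by case/andP: yI => ? ?; apply/andP; split; lra.
have hI : 0 <= h <= h by rewrite lexx ltW.
have oI : 0 <= (0 : R) <= h by rewrite lexx ltW.
have [_ H1] := key _ _ hI tI; have [_ H0] := key _ _ oI tI.
rewrite !subrKC addr0 in H1 H0.
rewrite -[affine (F (planeC (x0 + h, y)))]/(f _).
rewrite -[affine (F (planeC (x0, y)))]/(f _).
set p := planeC (x0 + h, y) in H1 *; set q := planeC (x0, y) in H0 *.
(* Both ends of the segment are compared with the affine approximation. *)
have E : 'D_1 f z0 * (h%:C)%C = (f p - f q) -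
    ((f p - f z0 - 'D_1 f z0 * planeC (h, y - y0)) -
     (f q - f z0 - 'D_1 f z0 * planeC (0, y - y0))).
  have -> : (h%:C)%C = planeC (h, y - y0) - planeC (0, y - y0).
    by rewrite /planeC /=; congr Complex; ring.
  ring.
have : l * h <= modC (f p - f q) +
    (l / 8 * (h + (y - y0)) + l / 8 * (0 + (y - y0))).
  have -> : l * h = modC ('D_1 f z0 * (h%:C)%C).
    by rewrite modCM modC_real ger0_norm// ltW.
  rewrite E; apply: le_trans (ler_modCD _ _) _; rewrite lerD2l modCN.
  apply: le_trans (ler_modCD _ _) _; rewrite modCN.
  exact: lerD.
have : l / 8 * (h + (y - y0)) <= l / 8 * (2 * h).
  by rewrite ler_pM2l//; case/andP: tI; lra.
have : l / 8 * (0 + (y - y0)) <= l / 8 * h.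
  by rewrite ler_pM2l//; case/andP: tI; lra.
have : 0 < l * h by rewrite mulr_gt0.
lra.
Qed.

(** M is the side of a cell: L bounds the gaps between the translations given by
    the recurrence, and h is the side of the square that is translated. *)
Lemma recurrent_energy {R : realType} (F : Cplx R -> sphere R) :
  meromorphic F -> ~ (exists c : sphere R, forall z, F z = c) ->
  locally_uniformly_recurrent F ->
  exists M c B : R, [/\ 0 < M, 0 < c & forall a : R * R, exists Q : set (R * R),
    [/\ measurable Q,
        forall q, Q q -> a.1 < q.1 < a.1 + M /\ a.2 < q.2 < a.2 + M,
        forall q, Q q -> F (planeC q) <> None /\
          modC (affine (F (planeC q))) <= B &
        (c%:E <= \int[lebesgue_measure \x lebesgue_measure]_(q in Q)
           (modC ('D_1 (@affine R \o F) (planeC q)) ^+ 2)%:E)%E]].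
Proof.
move=> mF ncF recF.
have [x0 [y0 [h [e [M0 [h0 e0 FK FKe]]]]]] := oscillating_square _ mF ncF.
pose K := [set z : Cplx R | x0 <= complex.Re (z : R[i]) <= x0 + h /\
                            y0 <= complex.Im (z : R[i]) <= y0 + h].
have FK' z : K z -> F z <> None /\ modC (affine (F z)) <= M0.
  by case: z => x y [/= xI yI]; exact: FK.
have [L L0 LP] :=
  recurrence_affine _ _ _ _ recF (compact_rectangle _ _ _ _) FK' e0.
exists (2 * L + h), (e ^+ 2), (M0 + e); split; first by lra.
  by rewrite exprn_gt0.
move=> [a1 a2].
(* With this target, w + K lies within the cell with corner (a1, a2). *)
have [w wL wP] := LP (planeC (a1 + L - x0, a2 + L - y0)).
set w1 := complex.Re (w : R[i]); set w2 := complex.Im (w : R[i]).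
have wE x y : planeC (x + w1, y + w2) = planeC (x, y) + w by rewrite planeCD.
have := le_lt_trans (ler_Re_modC _) wL; have := le_lt_trans (ler_Im_modC _) wL.
have -> : complex.Re (w - planeC (a1 + L - x0, a2 + L - y0) : R[i]) =
    w1 - (a1 + L - x0).
  by rewrite /w1; case: (w).
have -> : complex.Im (w - planeC (a1 + L - x0, a2 + L - y0) : R[i]) =
    w2 - (a2 + L - y0).
  by rewrite /w2; case: (w).
rewrite !ltr_norml => /andP[w2l w2u] /andP[w1l w1u].
pose Q : set (R * R) := `[x0 + w1, x0 + w1 + h] `*` `[y0 + w2, y0 + w2 + h].
have FQ q : Q q -> F (planeC q) <> None /\
    modC (affine (F (planeC q))) <= M0 + e.
  case: q => x y [/=]; rewrite !in_itv/= => /andP[x1 x2] /andP[y1 y2].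
  have Kz : K (planeC (x - w1, y - w2)).
    by split=> /=; apply/andP; split; lra.
  have [] := wP _ Kz; rewrite -wE !subrK => Fxy H; split => //.
  rewrite -[affine _](subrK (affine (F (planeC (x - w1, y - w2))))).
  apply: le_trans (ler_modCD _ _) _; rewrite addrC.
  apply: lerD; last exact: ltW.
  by have [] := FK' _ Kz.
exists Q; split => //.
- by apply: measurableX; exact: measurable_itv.
- move=> [x y] [/=]; rewrite !in_itv/= => /andP[x1 x2] /andP[y1 y2].
  by split; apply/andP; split; lra.
apply: square_energy => //; first by move=> q /FQ[].
move=> y yI; rewrite -[y](subrK w2) addrAC !wE.
set y' := y - w2.
have y'I : y0 <= y' <= y0 + h.
  by case/andP: yI => ? ?; rewrite /y'; apply/andP; split; lra.
have K1 : K (planeC (x0 + h, y')).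
  by split => //=; rewrite lexx andbT lerDl ltW.
have K2 : K (planeC (x0, y')).
  by split => //=; rewrite lexx/= lerDl ltW.
have [_ H1] := wP _ K1; have [_ H2] := wP _ K2.
have := FKe _ y'I.
set A := affine (F (planeC (x0 + h, y'))) in H1 *.
set B := affine (F (planeC (x0, y'))) in H2 *.
set A' := affine _ in H1 *; set B' := affine _ in H2 *.
have : modC (A - B) <= modC (A' - A) + (modC (A' - B') + modC (B' - B)).
  apply: le_trans (ler_modC_dist _ A' _) _; rewrite [modC (A - _)]modCB lerD2l.
  exact: ler_modC_dist.
lra.
Qed.

(** * Quadratic growth *)

(** Cells of side M are indexed by i, j < n with n about r / (2 M): they lie in
    the square of side r / 2, hence in the disk of radius r. *)
Lemma quadratic_area_growth {R : realType} (F : Cplx R -> sphere R) :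
  meromorphic F -> ~ (exists c : sphere R, forall z, F z = c) ->
  locally_uniformly_recurrent F ->
  exists c r0 : R, [/\ 0 < c, 0 < r0 & forall r, r0 <= r ->
    ((c * r ^+ 2)%:E <= spherical_area F r)%E].
Proof.
move=> mF ncF recF.
have [M [c [B [M0 c0 cells]]]] := recurrent_energy _ mF ncF recF.
have [Q QP] := choice cells.
pose k : R := ((1 + B ^+ 2) ^+ 2)^-1.
have k0 : 0 < k by rewrite invr_gt0 exprn_gt0// ltr_wpDr// sqr_ge0.
exists (k * c / (4 * M) ^+ 2), (4 * M); split.
- by rewrite divr_gt0 ?mulr_gt0// exprn_gt0// mulr_gt0.
- by rewrite mulr_gt0.
move=> r rM.
have r0 : 0 < r by apply: lt_le_trans rM; rewrite mulr_gt0.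
pose n := Num.truncn (r / (2 * M)).
have M2 : 0 < 2 * M by rewrite mulr_gt0.
have n_le : n%:R * M <= r / 2.
  have : n%:R <= r / (2 * M) by rewrite truncn_le// divr_ge0// ltW.
  rewrite ler_pdivlMr// => H; rewrite ler_pdivlMr//.
  by apply: le_trans H; rewrite -mulrA [M * 2]mulrC.
have n_ge : r / (4 * M) <= n%:R.
  have := truncnS_gt (r / (2 * M)); rewrite -/n -natr1 => H.
  have E : r / (2 * M) = r / (4 * M) + r / (4 * M) by field; rewrite gt_eqF.
  have : 1 <= r / (4 * M) by rewrite ler_pdivlMr ?mul1r// mulr_gt0.
  by move: H; rewrite E; lra.
pose a (ij : 'I_n * 'I_n) : R * R := (ij.1%:R * M, ij.2%:R * M).
have Qa ij q : Q (a ij) q -> ij.1%:R * M < q.1 < ij.1%:R * M + M /\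
    ij.2%:R * M < q.2 < ij.2%:R * M + M.
  by have [_ H _ _] := QP (a ij) => /H.
have iM (i : 'I_n) : 0 <= i%:R * M <= n%:R * M - M.
  rewrite mulr_ge0 ?(ltW M0)//= lerBrDr -{2}[M]mul1r -mulrDl natr1.
  by rewrite ler_pM2r// ler_nat.
rewrite /spherical_area.
apply: (@le_trans _ _ (k * c * (size (enum [set: 'I_n * 'I_n]%SET))%:R)%:E).
  rewrite -cardE cardsT card_prod card_ord lee_fin.
  have -> : k * c / (4 * M) ^+ 2 * r ^+ 2 = k * c * (r / (4 * M)) ^+ 2.
    rewrite [(r / _) ^+ 2]exprMn exprVn -[LHS]mulrA.
    by rewrite [((4 * M) ^+ 2)^-1 * _]mulrC.
  rewrite ler_pM2l ?mulr_gt0// natrM -expr2.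
  have rM0 : 0 <= r / (4 * M) by apply/ltW/divr_gt0 => //; rewrite mulr_gt0.
  by rewrite ler_pXn2r// nnegrE.
have := @ge0_integral_disjoint_lower _ _ _
  (@lebesgue_measure R \x @lebesgue_measure R)%E _ (enum [set: 'I_n * 'I_n]%SET)
  (Q \o a) [set p | modC (planeC p) < r] [set p | F (planeC p) <> None]
  (fun p => modC ('D_1 (@affine R \o F) (planeC p)) ^+ 2)
  (fun p => (spherical_derivative F (planeC p) ^+ 2)%:E) k c.
apply.
- exact: enum_uniq.
- by move=> ij; have [] := QP (a ij).
- move=> i j _ _ [q [/= /Qa[i1 i2] /Qa[j1 j2]]].
  have same (u v : nat) (t : R) : u%:R * M < t < u%:R * M + M ->
      v%:R * M < t < v%:R * M + M -> (u <= v)%N.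
    move=> /andP[ut _] /andP[_ tv]; rewrite -ltnS -(ltr_nat R).
    rewrite -(ltr_pM2r M0) -[v.+1%:R]natr1 mulrDl mul1r.
    exact: lt_trans tv.
  case: i j i1 i2 j1 j2 => [i1 i2] [j1 j2] /= I1 I2 J1 J2.
  congr (_, _); apply/val_inj/eqP; rewrite eqn_leq; apply/andP; split.
  - exact: same I1 J1.
  - exact: same J1 I1.
  - exact: same I2 J2.
  - exact: same J2 I2.
- move=> ij _ q /= Qq.
  have [/andP[x1 x2] /andP[y1 y2]] := Qa _ _ Qq.
  have /andP[i0 i1] := iM ij.1; have /andP[j0 j1] := iM ij.2.
  apply: le_lt_trans (ler_modC_Re_Im _) _ => /=.
  by rewrite !ger0_norm; lra.
- exact: measurable_finite_points.
- by move=> ij q /=; have [_ _ H _] := QP (a ij) => /H[].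
- exact: measurable_sqr_derive.
- by move=> x; rewrite sqr_ge0.
- by move=> x _; rewrite lee_fin sqr_ge0.
- exact: ltW.
- move=> ij q /=; have [_ _ H _] := QP (a ij) => /H[Fq FB].
  by rewrite lee_fin mulrC; exact: spherical_derivative_ge.
- by move=> ij; have [] := QP (a ij).
Qed.

(** Half of the range of integration already contributes: for r between rad / 2
    and rad the integrand is at least c r / pi. *)
Lemma quadratic_characteristic_growth {R : realType} (F : Cplx R -> sphere R)
    (c r0 : R) : 0 < c -> 0 < r0 ->
  (forall r, r0 <= r -> ((c * r ^+ 2)%:E <= spherical_area F r)%E) ->
  forall rad, 2 * r0 <= rad ->
  ((c / (4 * pi) * rad ^+ 2)%:E <= characteristic F rad)%E.
Proof.
move=> c0 r00 areaF rad radr.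
have rad0 : 0 < rad by apply: lt_le_trans radr; rewrite mulr_gt0.
have pi0 : 0 < pi :> R by exact: pi_gt0.
have muI : lebesgue_measure (`]rad / 2, rad[%classic : set R) = (rad / 2)%:E.
  rewrite lebesgue_measure_itv/= lte_fin.
  have -> : rad / 2 < rad by lra.
  by rewrite -EFinD; congr EFin; lra.
pose k : R := pi^-1 * (c * (rad / 2)).
have k0 : 0 < k by rewrite !mulr_gt0 ?invr_gt0.
have -> : c / (4 * pi) * rad ^+ 2 = k * (rad / 2).
  by rewrite /k invfM; move: (pi^-1) => p; field.
rewrite EFinM -muI.
have area0 r : (0 <= spherical_area F r)%E.
  by apply: integral_ge0 => p _; rewrite lee_fin sqr_ge0.
have := @cst_le_integral _ _ _ (@lebesgue_measure R) `]rad / 2, rad[ `]0, rad[ k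
  (fun r => ((pi^-1)%:E * spherical_area F r * (r^-1)%:E)%E).
apply.
- exact: measurable_itv.
- move=> r /=; rewrite !in_itv/= => /andP[r1 ->]; rewrite andbT.
  by apply: lt_trans r1; rewrite divr_gt0.
- exact: ltW.
- move=> r /=; rewrite in_itv/= => /andP[r1 _].
  by rewrite !mule_ge0// lee_fin invr_ge0 ltW.
move=> r /=; rewrite in_itv/= => /andP[r1 r2].
have rp : 0 < r by apply: lt_trans r1; rewrite divr_gt0.
have rr0 : r0 <= r by lra.
apply: (@le_trans _ _ ((pi^-1)%:E * (c * r ^+ 2)%:E * (r^-1)%:E)%E).
  rewrite -!EFinM lee_fin /k -mulrA ler_pM2l ?invr_gt0//.
  rewrite -mulrA ler_pM2l// expr2 mulfK ?gt_eqF//.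
  exact: ltW.
apply: lee_wpmul2r; first by rewrite lee_fin invr_ge0 ltW.
apply: lee_wpmul2l; first by rewrite lee_fin invr_ge0 ltW.
exact: areaF.
Qed.

Theorem theorem5 (R : realType) (F : Cplx R -> sphere R)
    (F_mero : meromorphic F)
    (F_nonconst : ~ exists c : sphere R, forall z : Cplx R, F z = c)
    (F_rec : locally_uniformly_recurrent F) :
  (0 < limf_einf
         (fun rad => characteristic F rad * ((rad ^+ 2)^-1)%:E) +oo%R)%E.
Proof.
have [c [r0 [c0 r00 areaF]]] := quadratic_area_growth _ F_mero F_nonconst F_rec.
pose k : R := c / (4 * pi).
have k0 : 0 < k by rewrite divr_gt0// mulr_gt0// pi_gt0.
apply: (@lt_le_trans _ _ k%:E); first by rewrite lte_fin.
rewrite limf_einfE; apply: le_ereal_sup_tmp.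
exists (ereal_inf [set (characteristic F rad * ((rad ^+ 2)^-1)%:E)%E |
                   rad in [set rad | 2 * r0 < rad]]).
  exists [set rad | 2 * r0 < rad] => //.
  by apply: nbhs_pinfty_gt; exact: num_real.
apply: le_ereal_inf_tmp => _ [rad /= radr <-].
have rad0 : 0 < rad by apply: lt_trans radr; rewrite mulr_gt0.
have -> : k%:E = ((k * rad ^+ 2)%:E * ((rad ^+ 2)^-1)%:E)%E.
  by rewrite -EFinM mulfK// gt_eqF// exprn_gt0.
apply: lee_wpmul2r; first by rewrite lee_fin invr_ge0 sqr_ge0.
by apply: quadratic_characteristic_growth areaF _ _ => //; exact: ltW.
Qed.
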